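(* Let $q=\|\cdot\|_1$ or $q=\|\cdot\|_\infty$ on $\mathbb{R}^{n_1}$, and let $(\bar y,\bar u,\bar v)$ be a solution of the KKT system $$A^{T}u+D^{T}v=0,\quad Ay-b\in\partial h^{*}(u),\quad Dy\in\partial q^{*}(v).$$ Then the strict Robinson constraint qualification (SRCQ) of the dual problem, $$A^{T}\{d : h^{*\downarrow}_{-}(\bar u;d)=\langle A\bar y-b,d\rangle\}+D^{T}\{d : q^{*\downarrow}_{-}(\bar v;d)=\langle D\bar y,d\rangle\}=\mathbb{R}^{n_1},$$ holds if and only if the critical cone of the primal problem $\min_{y\in\mathbb{R}^{n_1}}\{h(Ay-b)+q(Dy)\}$, $$\mathcal{C}(\bar y)=\{d\in\mathbb{R}^{n_1} : h^{\downarrow}_{-}(A\bar y-b;Ad)+q^{\downarrow}_{-}(D\bar y;Dd)=0\},$$ contains only the zero element.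
   Context: Setting. Let $n\ge 3$ be an integer, $n_1=n(n-1)/2$, $n_2=n(n-1)(n-2)/2$. For a real symmetric $n\times n$ matrix $X=(x_{ij})$ put $\mathrm{trivec}(X)=[x_{12},x_{13},x_{23},\ldots,x_{1n},\ldots,x_{n-1,n}]^T\in\mathbb{R}^{n_1}$. $A\in\mathbb{R}^{n_2\times n_1}$ is the triangle inequality matrix: for each $1\le i<j<k\le n$ it has three rows, for which the corresponding components of $A\,\mathrm{trivec}(X)$ are $x_{ij}-x_{ik}-x_{jk}$, $x_{ik}-x_{ij}-x_{jk}$ and $x_{jk}-x_{ij}-x_{ik}$. $\widetilde X$ is a given nonnegative symmetric zero-diagonal matrix, $b=-A\,\mathrm{trivec}(\widetilde X)$, and $D=\mathrm{diag}(\mathrm{trivec}(W))$ for a given symmetric weight matrix $W$, all diagonal entries of $D$ being positive. $h=\delta_{C}$ is the indicator function of $C=\mathbb{R}^{n_2}_-$. $f^*$ denotes the convex conjugate and $\partial f$ the convex subdifferential. One has $h^*=\delta_{C_1}$ with $C_1=\mathbb{R}^{n_2}_+$ and $q^*=\delta_{C_2}$, where $C_2=\{v:\|v\|_\infty\le1\}$ if $q=\|\cdot\|_1$ and $C_2=\{v:\|v\|_1\le1\}$ if $q=\|\cdot\|_\infty$. For an extended-real-valued $f$ finite at $x$, the lower directional epiderivative is $f^{\downarrow}_-(x;d)=\liminf_{t\downarrow0,\,d'\to d}\frac{f(x+td')-f(x)}{t}$; for the indicator function of a closed convex set $S$ at $x\in S$ it equals $\delta_{\mathcal{T}_S(x)}(d)$,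 with $\mathcal{T}_S(x)$ the tangent cone. *)

(* Defs.v *)
From mathcomp Require Import all_boot all_order all_algebra.
From mathcomp Require Import all_classical all_reals all_analysis.

Set Implicit Arguments.
Unset Strict Implicit.
Unset Printing Implicit Defensive.

Import Order.TTheory GRing.Theory Num.Theory.
Import numFieldNormedType.Exports.

Local Open Scope classical_set_scope.
Local Open Scope ring_scope.

(** * Convex analysis on ['cV[R]_m] *)

Definition dot (R : realType) (m : nat) (x y : 'cV[R]_m) : R :=
  \sum_i x i 0 * y i 0.

Definition norm1 (R : realType) (m : nat) (x : 'cV[R]_m) : R :=
  \sum_i `|x i 0|.

(* [mx_norm] is the largest modulus of an entry, hence the sup norm here. *)
Definition norm_oo (R : realType) (m : nat) (x : 'cV[R]_m) : R := mx_norm x.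

Definition indicator (R : realType) (m : nat) (S : set 'cV[R]_m)
    (x : 'cV[R]_m) : \bar R :=
  if x \in S then 0%E else +oo%E.

Definition conjugate (R : realType) (m : nat) (f : 'cV[R]_m -> \bar R)
    (u : 'cV[R]_m) : \bar R :=
  ereal_sup (range (fun x : 'cV[R]_m => (dot u x)%:E - f x)%E).

(* Empty where [f] is not finite. *)
Definition subdiff (R : realType) (m : nat) (f : 'cV[R]_m -> \bar R)
    (x : 'cV[R]_m) : set 'cV[R]_m :=
  [set g | f x \is a fin_num /\
           forall y : 'cV[R]_m, (f x + (dot g (y - x))%:E <= f y)%E].

(* The lower limit is taken jointly as t decreases to 0 and d' tends to d, with
   z = (t, d'); it is meaningful only where [f x] is finite. *)
Definition epiderivative (R : realType) (m : nat) (f : 'cV[R]_m -> \bar R)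
    (x d : 'cV[R]_m) : \bar R :=
  limf_einf (fun z : R * 'cV[R]_m =>
      (f (x + z.1 *: z.2)%R - f x) * (z.1^-1)%:E)%E
    (filter_prod (0 : R)^'+ (nbhs d)).

Definition nonpos_orthant (R : realType) (m : nat) : set 'cV[R]_m :=
  [set x | forall i, x i 0 <= 0].

(** * The problem min_y h (A y - b) + q (D y) *)

Definition kkt_solution (R : realType) (m1 m2 : nat)
    (A : 'M[R]_(m2, m1)) (D : 'M[R]_m1) (b : 'cV[R]_m2)
    (h : 'cV[R]_m2 -> \bar R) (q : 'cV[R]_m1 -> \bar R)
    (y : 'cV[R]_m1) (u : 'cV[R]_m2) (v : 'cV[R]_m1) : Prop :=
  [/\ A^T *m u + D^T *m v = 0,
      subdiff (conjugate h) u (A *m y - b)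
    & subdiff (conjugate q) v (D *m y)].

Definition dual_SRCQ (R : realType) (m1 m2 : nat)
    (A : 'M[R]_(m2, m1)) (D : 'M[R]_m1) (b : 'cV[R]_m2)
    (h : 'cV[R]_m2 -> \bar R) (q : 'cV[R]_m1 -> \bar R)
    (y : 'cV[R]_m1) (u : 'cV[R]_m2) (v : 'cV[R]_m1) : Prop :=
  [set A^T *m d + D^T *m e | d in
     [set d | epiderivative (conjugate h) u d = (dot (A *m y - b) d)%:E]
   & e in
     [set e | epiderivative (conjugate q) v e = (dot (D *m y) e)%:E]]
  = [set: 'cV[R]_m1].

Definition critical_cone (R : realType) (m1 m2 : nat)
    (A : 'M[R]_(m2, m1)) (D : 'M[R]_m1) (b : 'cV[R]_m2)
    (h : 'cV[R]_m2 -> \bar R) (q : 'cV[R]_m1 -> \bar R)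
    (y : 'cV[R]_m1) : set 'cV[R]_m1 :=
  [set d | (epiderivative h (A *m y - b)%R (A *m d)
            + epiderivative q (D *m y) (D *m d) = 0)%E].

(** * Triangle inequalities *)

Definition dim1 (n : nat) : nat := (n * (n - 1))./2.
Definition dim2 (n : nat) : nat := (n * (n - 1) * (n - 2))./2.

(* Column by column: (1,2), (1,3), (2,3), (1,4), ... *)
Definition pair_seq (n : nat) : seq ('I_n * 'I_n) :=
  [seq (i, j) | j : 'I_n <- enum 'I_n,
                i : 'I_n <- [seq i : 'I_n <- enum 'I_n | (i < j)%N]].

(* The row [(a, b, c)] stands for the expression x_a - x_b - x_c. *)
Definition row_seq (n : nat) : seq (('I_n * 'I_n) * ('I_n * 'I_n) * ('I_n * 'I_n)) :=
  flatten
    [seq [:: ((p.1, p.2), (p.1, k), (p.2, k));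
             ((p.1, k), (p.1, p.2), (p.2, k));
             ((p.2, k), (p.1, p.2), (p.1, k))]
    | k : 'I_n <- enum 'I_n,
      p : 'I_n * 'I_n <- [seq p : 'I_n * 'I_n <- pair_seq n | (p.2 < k)%N]].

Lemma sumn_enum (n : nat) (f : nat -> nat) :
  sumn [seq f (val i) | i <- enum 'I_n] = (\sum_(i < n) f i)%N.
Proof. by rewrite sumnE big_map big_enum. Qed.

Lemma size_below (n : nat) (j : nat) : (j <= n)%N ->
  size [seq i : 'I_n <- enum 'I_n | (i < j)%N] = j.
Proof.
move=> jn; rewrite size_filter -(count_map (@nat_of_ord n) (fun i => i < j)%N).
rewrite val_enum_ord -{1}(subnKC jn) iotaD count_cat add0n.
rewrite (_ : count _ (iota 0 j) = j); last first.
  rewrite -[RHS](size_iota 0); apply/eqP; rewrite -all_count.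
  by apply/allP => i; rewrite mem_iota.
rewrite (_ : count _ _ = 0%N) ?addn0//; apply/eqP.
rewrite -leqn0 leqNgt -has_count; apply/hasPn => i.
by rewrite mem_iota -leqNgt => /andP[].
Qed.

Lemma count_pair_seq (n k : nat) : (k <= n)%N ->
  count (fun p : 'I_n * 'I_n => p.2 < k)%N (pair_seq n) = 'C(k, 2).
Proof.
move=> kn; rewrite /pair_seq count_flatten -map_comp.
rewrite (eq_map (g := (fun j => if (j < k)%N then j else 0%N) \o val)); last first.
  move=> j /=; rewrite count_map; case: ifP => jk.
    rewrite -[RHS](size_below (ltnW (ltn_ord j))) -count_predT.
    by apply: eq_count => i /=.
  rewrite -(count_pred0 [seq i : 'I_n <- enum 'I_n | (i < j)%N]).
  by apply: eq_count => i /=.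
rewrite sumn_enum -big_mkcond /=.
by rewrite (big_ord_narrow kn) -bin2_sum big_mkord.
Qed.

Lemma size_pair_seq (n : nat) : size (pair_seq n) == dim1 n.
Proof.
rewrite -(count_predT (pair_seq n)) (eq_count (a2 := fun p : 'I_n * 'I_n => (p.2 < n)%N)).
  by rewrite count_pair_seq // bin2 /dim1 subn1.
by move=> p; rewrite /= ltn_ord.
Qed.

Lemma size_row_seq (n : nat) : size (row_seq n) == dim2 n.
Proof.
rewrite /row_seq size_flatten /shape -map_comp map_allpairs.
rewrite (_ : sumn _ = 'C(n, 3) * 3)%N; last first.
  rewrite sumn_flatten -map_comp.
  rewrite (eq_map (g := (fun k => 'C(k, 2) * 3)%N \o val)); last first.
    move=> k /=; rewrite -(count_pair_seq (ltnW (ltn_ord k))) -size_filter.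
    by elim: [seq _ <- _ | _] => //= p s ->; rewrite mulSn.
  rewrite -enumT sumn_enum -big_distrl /=; congr (_ * _)%N.
  elim: n => [|n IH]; first by rewrite big_ord0.
  by rewrite big_ord_recr /= IH binS.
apply/eqP; rewrite /dim2 -[LHS]doubleK; congr _./2.
rewrite -muln2 -mulnA (_ : 3 * 2 = 3`!)%N // bin_ffact.
by rewrite !ffactnS ffactn0 muln1 -!subn1 -!subnDA mulnA.
Qed.

Definition pair_tuple (n : nat) : (dim1 n).-tuple ('I_n * 'I_n) :=
  Tuple (size_pair_seq n).

Definition row_tuple (n : nat) :
    (dim2 n).-tuple (('I_n * 'I_n) * ('I_n * 'I_n) * ('I_n * 'I_n)) :=
  Tuple (size_row_seq n).

Definition trivec (R : realType) (n : nat) (X : 'M[R]_n) : 'cV[R]_(dim1 n) :=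
  \col_p X (tnth (pair_tuple n) p).1 (tnth (pair_tuple n) p).2.

Definition triangle_mx (R : realType) (n : nat) : 'M[R]_(dim2 n, dim1 n) :=
  \matrix_(r, p)
    let: (a, b, c) := tnth (row_tuple n) r in
    let e := tnth (pair_tuple n) p in
    (e == a)%:R - (e == b)%:R - (e == c)%:R.

Lemma mem_pair_seq (n : nat) (e : 'I_n * 'I_n) :
  (e \in pair_seq n) = (e.1 < e.2)%N.
Proof.
case: e => i j /=; apply/allpairsPdep/idP => [[j' [i' [_ + [-> ->]]]]|ij].
  by rewrite mem_filter => /andP[].
by exists j, i; rewrite [i \in _]mem_filter ij !mem_enum.
Qed.

Lemma uniq_pair_seq (n : nat) : uniq (pair_seq n).
Proof.
apply: allpairs_uniq_dep => [|j _|]; first exact: enum_uniq.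
  by apply: filter_uniq; exact: enum_uniq.
by case=> [j i] [j' i'] _ _ /= [] -> ->.
Qed.

Lemma mem_row_seq (n : nat) (r : ('I_n * 'I_n) * ('I_n * 'I_n) * ('I_n * 'I_n)) :
  r \in row_seq n <->
  exists i j k : 'I_n, (i < j < k)%N /\
    r \in [:: ((i, j), (i, k), (j, k)); ((i, k), (i, j), (j, k));
              ((j, k), (i, j), (i, k))].
Proof.
split=> [/flattenP[s /allpairsPdep[k [[i j] [_ + ->]]] rs]|].
  rewrite mem_filter mem_pair_seq /= => /andP[jk ij].
  by exists i, j, k; rewrite ij jk.
move=> [i [j [k [/andP[ij jk] rs]]]]; apply/flattenP; eexists; last exact: rs.
apply/allpairsPdep; exists k, (i, j); split; rewrite ?mem_enum //.
by rewrite mem_filter mem_pair_seq /= jk.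
Qed.

Lemma triangle_mx_trivec (R : realType) (n : nat) (X : 'M[R]_n) r :
  (triangle_mx R n *m trivec X) r 0 =
  let: (a, b, c) := tnth (row_tuple n) r in
  X a.1 a.2 - X b.1 b.2 - X c.1 c.2.
Proof.
have pick (a : 'I_n * 'I_n) : (a.1 < a.2)%N ->
    \sum_p (tnth (pair_tuple n) p == a)%:R * trivec X p 0 = X a.1 a.2.
  rewrite -mem_pair_seq => /(tnthP (pair_tuple n))[p ->].
  rewrite (bigD1 p) //= eqxx mul1r mxE big1 ?addr0 // => p' p'p.
  by rewrite (inj_eq (tuple_uniqP (pair_tuple n) (uniq_pair_seq n)))
    (negbTE p'p) mul0r.
rewrite mxE; under eq_bigr do rewrite mxE.
have := mem_tnth r (row_tuple n).
case: (tnth (row_tuple n) r) => [[a b] c] /mem_row_seq[i [j [k]]].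
move=> [/andP[ij jk] abc]; have ik := ltn_trans ij jk.
under eq_bigr do rewrite !mulrBl.
have [a_lt b_lt c_lt] : [/\ a.1 < a.2, b.1 < b.2 & c.1 < c.2]%N.
  by move: abc; rewrite !inE => /or3P[] /eqP[] -> -> ->.
by rewrite !sumrB !pick.
Qed.

(* Main.v *)
(** The function [h] and both norms [q] are support functions [f w = sup_C <., w>]
   of polyhedra, and their conjugates are the indicators of these [C].
   Stationarity makes the critical cone of the primal problem the set of [d] at
   which both inequalities [<u, A d> <= h'(A y - b; A d)] and
   [<v, D d> <= q'(D y; D d)] are equalities. For a support function [f] of a
   polyhedron, with conjugate [g], the cones [{e : f'(w; e) = <u, e>}] and
   [{k : g'(u; k) = <w, k>}] are polar to each other. Hence the critical cone is
   the polar of [A^T K1 + D^T K2], the left-hand side of the SRCQ, and a convex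
   cone of R^m with trivial polar is R^m. *)
Require Import Defs.
From mathcomp Require Import all_boot all_order all_algebra.
From mathcomp Require Import all_classical all_reals all_analysis.
From mathcomp Require Import ring lra.

Set Implicit Arguments.
Unset Strict Implicit.

Import Order.TTheory GRing.Theory Num.Theory.
Import numFieldNormedType.Exports.

Local Open Scope classical_set_scope.
Local Open Scope ring_scope.

(** * Separation for convex cones *)

Definition sublinear {R : realType} {V : lmodType R} (p : V -> R) : Prop :=
  (forall x y, p (x + y) <= p x + p y) /\
  (forall a x, 0 < a -> p (a *: x) <= a * p x).

Lemma sublinear0 {R : realType} {V : lmodType R} (p : V -> R) :
  sublinear p -> p 0 = 0.
Proof.
move=> [pD pZ]; have := pD 0 0; have := pZ 2^-1 0.
by rewrite scaler0 addr0 invr_gt0 ltr0n => /(_ isT); lra.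
Qed.

Lemma sublinearZ_ge {R : realType} {V : lmodType R} (p : V -> R) (t : R) (e : V) :
  sublinear p -> t * p e <= p (t *: e).
Proof.
move=> sp; have p0 := sublinear0 sp; case: sp => pD pZ.
have [t0|t0|->] := ltgtP t 0; last by rewrite mul0r scale0r p0.
  have := pD (t *: e) (- t *: e); rewrite -scalerDl subrr scale0r p0.
  by have := pZ (- t) e; rewrite oppr_gt0 t0 => /(_ isT); lra.
have := pZ t^-1 (t *: e); rewrite invr_gt0 t0 => /(_ isT).
rewrite scalerA mulVf ?gt_eqF // scale1r => pe.
by rewrite -ler_pdivlMl.
Qed.

(** One step of Hahn-Banach: [p'] is the infimum over real [t] of p(x + t e) - t p(e). Taking t = -1
    at e and t = 1 at -e bounds the two values by p(e) and -p(e). *)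
Lemma sublinear_linearize {R : realType} {V : lmodType R} (p : V -> R) (e : V) :
  sublinear p ->
  exists p' : V -> R,
    [/\ sublinear p', forall x, p' x <= p x & p' e + p' (- e) <= 0].
Proof.
move=> sp; have p0 := sublinear0 sp; have [pD pZ] := sp.
pose E x := range (fun t : R => p (x + t *: e) - t * p e).
(* This bound makes [inf (E x)] a true infimum rather than a default value. *)
have Elb x : lbound (E x) (- p (- x)).
  move=> _ [t _ <-]; have := sublinearZ_ge t e sp.
  by have := pD (x + t *: e) (- x); rewrite addrAC subrr add0r; lra.
have infE x t : inf (E x) <= p (x + t *: e) - t * p e.
  by apply: ge_inf; [exists (- p (- x)) | exists t].
have lbE x r : (forall t, r <= p (x + t *: e) - t * p e) -> r <= inf (E x).
  move=> rE; apply: lb_le_inf => [|_ [t _ <-] //].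
  by exists (p (x + 0 *: e) - 0 * p e), 0.
exists (fun x => inf (E x)); split.
- split=> [x y|a x a0].
    rewrite -lerBlDr; apply/lbE => t; rewrite lerBlDr -lerBlDl.
    apply/lbE => s; rewrite lerBlDr; apply: le_trans (infE _ (s + t)) _.
    have := pD (x + t *: e) (y + s *: e).
    by rewrite addrACA -scalerDl (addrC t); lra.
  rewrite -ler_pdivrMl //; apply/lbE => t; rewrite ler_pdivrMl //.
  apply: le_trans (infE _ (a * t)) _.
  by have := pZ a (x + t *: e) a0; rewrite scalerDr scalerA; lra.
- by move=> x; apply: le_trans (infE x 0) _; rewrite scale0r addr0; lra.
- have := infE e (-1); have := infE (- e) 1.
  by rewrite scaleN1r scale1r addNr subrr p0; lra.
Qed.

(** Lowering the function keeps the inequalities already gained, so directions can be treated one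
    after another. *)
Lemma sublinear_linearize_seq {R : realType} {V : lmodType R}
    (s : seq V) (p : V -> R) :
  sublinear p ->
  exists p' : V -> R, [/\ sublinear p', forall x, p' x <= p x
    & {in s, forall e, p' e + p' (- e) <= 0}].
Proof.
move=> sp; elim: s => [|e s [p1 [sp1 p1p p1s]]]; first by exists p.
have [p2 [sp2 p21 p2e]] := sublinear_linearize e sp1.
exists p2; split=> // [x|e']; first exact: le_trans (p21 x) (p1p x).
rewrite inE => /predU1P[-> //|e's].
by apply: le_trans (p1s _ e's); rewrite lerD.
Qed.

(** * The inner product *)

Section Dot.
Context {R : realType} {m : nat}.
Implicit Types x y z : 'cV[R]_m.

Lemma dotC x y : dot x y = dot y x.
Proof. by apply: eq_bigr => i _; rewrite mulrC. Qed.

Lemma dotDl x y z : dot (x + y) z = dot x z + dot y z.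
Proof. by rewrite -big_split; apply: eq_bigr => i _; rewrite mxE mulrDl. Qed.

Lemma dotZl a x z : dot (a *: x) z = a * dot x z.
Proof. by rewrite mulr_sumr; apply: eq_bigr => i _; rewrite mxE mulrA. Qed.

Lemma dotNl x z : dot (- x) z = - dot x z.
Proof. by rewrite -scaleN1r dotZl mulN1r. Qed.

Lemma dotBl x y z : dot (x - y) z = dot x z - dot y z.
Proof. by rewrite dotDl dotNl. Qed.

Lemma dot0l z : dot 0 z = 0.
Proof. by rewrite -(scale0r z) dotZl mul0r. Qed.

Lemma dotDr x y z : dot x (y + z) = dot x y + dot x z.
Proof. by rewrite dotC dotDl !(dotC x). Qed.

Lemma dotZr a x z : dot x (a *: z) = a * dot x z.
Proof. by rewrite dotC dotZl dotC. Qed.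

Lemma dotNr x z : dot x (- z) = - dot x z.
Proof. by rewrite dotC dotNl dotC. Qed.

Lemma dotBr x y z : dot x (y - z) = dot x y - dot x z.
Proof. by rewrite dotDr dotNr. Qed.

Lemma dot0r x : dot x 0 = 0.
Proof. by rewrite dotC dot0l. Qed.

Lemma dot_delta x i : dot x (delta_mx i 0) = x i 0.
Proof.
rewrite /dot (bigD1 i) //= big1 => [|j ji]; rewrite !mxE ?eqxx ?mulr1 ?addr0 //.
by rewrite (negbTE ji) mulr0.
Qed.

Lemma dot_self_eq0 x : dot x x <= 0 -> x = 0.
Proof.
move=> xx; have ge0 i : true -> 0 <= x i 0 * x i 0 by rewrite -expr2 sqr_ge0.
apply/matrixP => i j; rewrite ord1 mxE.
have /eqP : dot x x = 0 by apply/le_anti; rewrite xx sumr_ge0.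
by rewrite psumr_eq0 // => /allP/(_ i (mem_index_enum _)); rewrite mulf_eq0 orbb => /eqP.
Qed.

Lemma cV_sum_delta x : x = \sum_i x i 0 *: delta_mx i 0.
Proof.
by rewrite {1}[x]matrix_sum_delta; apply: eq_bigr => i _; rewrite big_ord1.
Qed.

Lemma dot_continuous x : continuous (dot x).
Proof.
move=> z; apply: (cvg_big add_continuous (F := nbhs z)) => i _.
by apply: cvgM; [exact: cvg_cst | exact: coord_continuous].
Qed.

End Dot.

Lemma dot_mulmx_tr {R : realType} {m n : nat} (A : 'M[R]_(m, n)) u d :
  dot (A^T *m u) d = dot u (A *m d).
Proof.
rewrite /dot; under eq_bigr do rewrite mxE mulr_suml.
rewrite exchange_big /=; apply: eq_bigr => i _.
by rewrite [(A *m d) _ _]mxE [RHS]mulr_sumr; apply: eq_bigr => j _; rewrite mxE -mulrA mulrCA.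
Qed.

(** Hahn-Banach in coordinates: once [p] is lowered to be linear along each basis vector, its values
    there are the coordinates of [d]. *)
Lemma sublinear_dominates_dot {R : realType} {m : nat} (p : 'cV[R]_m -> R) :
  sublinear p -> exists d : 'cV[R]_m, forall x, dot d x <= p x.
Proof.
move=> sp; pose s : seq 'cV[R]_m := [seq delta_mx i 0 | i <- enum 'I_m].
have [p' [sp' p'p p's]] := sublinear_linearize_seq s sp.
exists (\col_i p' (delta_mx i 0)) => x; apply: le_trans (p'p x).
have [p'D p'Z] := sp'; have p'0 := sublinear0 sp'.
have p'e i a : p' (a *: delta_mx i 0) <= a * p' (delta_mx i 0).
  have [a0|a0|->] := ltgtP a 0; last by rewrite scale0r mul0r p'0.
    have e_s : delta_mx i 0 \in s by apply: map_f; rewrite mem_enum.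
    have := p'Z (- a) (- delta_mx i 0); rewrite scalerN scaleNr opprK oppr_gt0.
    move=> /(_ a0) /le_trans; apply; rewrite mulNr -mulrN ler_nM2l //.
    by have := p's _ e_s; lra.
  exact: p'Z.
have p'sum z : p' z <= \sum_i z i 0 * p' (delta_mx i 0).
  rewrite {1}(cV_sum_delta z); elim/big_ind2 : _ => // [|? ? ? ? le1 le2].
    by rewrite p'0.
  by apply: le_trans (p'D _ _) _; exact: lerD.
have -> : dot (\col_i p' (delta_mx i 0)) x = - \sum_i (- x) i 0 * p' (delta_mx i 0).
  by rewrite -sumrN; apply: eq_bigr => i _; rewrite !mxE mulNr opprK mulrC.
(* The upper bound at -x becomes a lower bound at x, because 0 <= p'(x) + p'(-x). *)
have := p'sum (- x); have := p'D x (- x); rewrite subrr p'0; lra.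
Qed.

(** A largest independent family in [L], stored as the columns of [M], spans [L]. It is not a basis
    of the whole space, so [M] has a nonzero left kernel vector. *)
Lemma orthogonal_of_proper_subspace {R : realType} {m : nat}
    (L : set 'cV[R]_m) :
  L 0 -> (forall x y, L x -> L y -> L (x + y)) ->
  (forall a x, L x -> L (a *: x)) -> L <> setT ->
  exists2 d, d != 0 & forall x, L x -> dot x d = 0.
Proof.
move=> L0 LD LZ LT.
pose P r := `[< exists M : 'M[R]_(m, r), row_free M^T /\ forall j, L (col j M) >].
have P0 : exists r, P r.
  exists 0; apply/asboolP; exists 0; split=> [|[]//].
  by rewrite /row_free eqn_leq rank_leq_row leq0n.
have Pm r : P r -> (r <= m)%N.
  by move/asboolP => [M [/eqP rk _]]; move: (rank_leq_col M^T); rewrite rk.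
case: (ex_maxnP P0 Pm) => r /asboolP[M [freeM LM]] maxr.
have Lmul (c : 'cV_r) : L (M *m c).
  have -> : M *m c = \sum_j c j 0 *: col j M.
    apply/matrixP => i k; rewrite ord1 mxE summxE.
    by apply: eq_bigr => j _; rewrite !mxE mulrC.
  by elim/big_ind : _ => // j _; apply: LZ.
have sub x : L x -> (x^T <= M^T)%MS.
  (* A vector outside the span could be appended to [M], against the maximality of [r]. *)
  move=> Lx; apply/negPn/negP => xM.
  suff : (r + 1 <= r)%N by rewrite addn1 ltnn.
  apply: maxr; apply/asboolP; exists (row_mx M x); split=> [|j].
    rewrite tr_row_mx /row_free eqn_leq rank_leq_row /=.
    rewrite -addsmxE addn1 ltnNge; apply: contra xM => rk.
    apply: submx_trans (addsmxSr M^T _) _.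
    have /mxrank_leqif_sup <- := addsmxSl M^T x^T.
    by rewrite eqn_leq mxrankS ?addsmxSl // (eqP freeM).
  case: (split_ordP j) => k ->; first by rewrite colKl.
  by rewrite colKr (_ : col k x = x) //; apply/matrixP => i l; rewrite !ord1 mxE.
have Mfull : ~~ row_full M^T.
  apply/negP => Mf; apply: LT; apply/seteqP; split=> // x _.
  have /submxP[c xc] : (x^T <= M^T)%MS by exact: submx_full.
  by rewrite -[x]trmxK xc trmx_mul trmxK; exact: Lmul.
have : kermx M != 0.
  rewrite kermx_eq0; apply: contra Mfull.
  by rewrite /row_free /row_full mxrank_tr.
move=> /rowV0Pn[d dker d0]; exists d^T; first by rewrite trmx_eq0.
move=> x /sub /submxP[c xc].
have dM : d *m M = 0 by apply/sub_kermxP.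
have -> : dot x d^T = (d *m x) 0 0.
  by rewrite mxE; apply: eq_bigr => i _; rewrite mxE mulrC.
by rewrite -[x]trmxK xc trmx_mul trmxK mulmxA dM mul0mx mxE.
Qed.

(** If K - K is a proper subspace, a vector orthogonal to it works. Otherwise [K] has an interior
    point g, and inf {t : t g - x in K} is sublinear; the negative of a linear functional below it
    lies in the polar. *)
Lemma cone_polar_nontrivial {R : realType} {m : nat} (K : set 'cV[R]_m) :
  K 0 -> (forall x y, K x -> K y -> K (x + y)) ->
  (forall a x, 0 < a -> K x -> K (a *: x)) -> K <> setT ->
  exists2 d, d != 0 & forall x, K x -> dot x d <= 0.
Proof.
move=> K0 KD KZ KT.
have KZ0 a x : 0 <= a -> K x -> K (a *: x).
  by rewrite le_eqVlt => /predU1P[<- _|]; [rewrite scale0r | exact: KZ].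
pose L := [set x | exists k k', [/\ K k, K k' & x = k - k']].
have KL x : K x -> L x by move=> Kx; exists x, 0; rewrite subr0.
have [LT|LT] := pselect (L = setT); last first.
  have [|x y|a x||d d0 dL] := @orthogonal_of_proper_subspace R m L.
  - exact: KL.
  - move=> [k1 [k1' [K1 K1' ->]]] [k2 [k2' [K2 K2' ->]]].
    by exists (k1 + k2), (k1' + k2'); split; [exact: KD..|rewrite opprD addrACA].
  - move=> [k [k' [Kk Kk' ->]]]; have [a0|a0] := leP 0 a.
      by exists (a *: k), (a *: k'); split; [exact: KZ0..|rewrite scalerBr].
    exists (- a *: k'), (- a *: k); have a0' : 0 <= - a by lra.
    by split; [exact: KZ0..|rewrite !scaleNr opprK scalerBr addrC].
  - exact: LT.
  - by exists d => // x /KL /dL ->.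
have Lall x : L x by rewrite LT.
have /choice[k Pk] : forall i : 'I_m, exists k : 'cV[R]_m * 'cV[R]_m,
    [/\ K k.1, K k.2 & delta_mx i 0 = k.1 - k.2].
  by move=> i; have [k [k' H]] := Lall (delta_mx i 0); exists (k, k').
(* [g] is an interior point of [K]: it absorbs every direction. *)
pose g := \sum_i ((k i).1 + (k i).2).
have Kg : K g.
  by apply: (big_ind K) => // i _; case: (Pk i) => Kk Kk' _; exact: KD.
have core x : exists s, K (s *: g - x).
  (* Coordinatewise, |x_i| (k + k') - x_i (k - k') is 2 |x_i| k' or 2 |x_i| k, according to the sign
     of x_i. *)
  exists (\sum_i `|x i 0|).
  rewrite {2}(cV_sum_delta x) scaler_suml -sumrB.
  apply: (big_ind K) => // i _; have [Kk Kk' kE] := Pk i.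
  rewrite /g (bigD1 i) //= scalerDr addrAC; apply: (KD).
    rewrite kE; have [x0|x0] := leP 0 (x i 0).
      rewrite ger0_norm // -scalerBr opprB addrACA (addrC (k i).2) addrACA.
      rewrite subrr add0r.
      by apply: KZ0 => //; exact: KD.
    rewrite ltr0_norm // -[X in _ - X]opprK -scaleNr opprK -scalerDr.
    rewrite addrACA subrr addr0.
    by apply: KZ0; [rewrite oppr_ge0 ltW | exact: KD].
  apply: KZ0 => //; apply: (big_ind K) => // j _.
  by case: (Pk j) => ? ? _; exact: KD.
(* A negative multiple of g in [K] would cancel the term s g supplied by [core], and [K] would
   contain every x. *)
have tg_ge0 t : K (t *: g) -> 0 <= t.
  move=> Ktg; rewrite leNgt; apply/negP => t0; apply: KT; apply/seteqP.
  split=> // x _; have [s Ks] := core (- x); rewrite opprK in Ks.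
  have : K (s *: g + x + (`|s| / - t) *: (t *: g)).
    by apply: KD => //; apply: KZ0 => //; rewrite divr_ge0 // oppr_ge0 ltW.
  rewrite scalerA invrN mulrN mulNr divfK ?lt_eqF // addrAC -scalerDl => Kx.
  have : K ((s - `|s|) *: g + x + (`|s| - s) *: g).
    by apply: KD => //; apply: KZ0 => //; rewrite subr_ge0 ler_norm.
  by rewrite addrAC -scalerDl addrA subrK subrr scale0r add0r.
pose S x := [set t | K (t *: g - x)].
have Slb x s : K (s *: g + x) -> lbound (S x) (- s).
  move=> Ks t St; rewrite -subr_ge0 opprK; apply: tg_ge0.
  by have := KD _ _ St Ks; rewrite addrACA -scalerDl addNr addr0.
have infS x t : K (t *: g - x) -> inf (S x) <= t.
  move=> Kt; have [s Ks] := core (- x); rewrite opprK in Ks.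
  by apply: ge_inf => //; exists (- s); exact: Slb.
have lbS x r : (forall t, K (t *: g - x) -> r <= t) -> r <= inf (S x).
  by move=> rS; apply: lb_le_inf => //; exact: core.
have [|d dp] := @sublinear_dominates_dot _ _ (fun x => inf (S x)).
  split=> [x y|a x a0].
    rewrite -lerBlDr; apply/lbS => t Kt; rewrite lerBlDr -lerBlDl.
    apply/lbS => s Ks; rewrite lerBlDl; apply: infS.
    by rewrite scalerDl opprD addrACA; exact: KD.
  rewrite -ler_pdivrMl //; apply/lbS => t Kt; rewrite ler_pdivrMl //.
  by apply: infS; rewrite -scalerA -scalerBr; exact: KZ.
exists (- d).
  (* At x = -g the infimum is at most -1, which rules out d = 0. *)
  apply/eqP => /eqP; rewrite oppr_eq0 => /eqP d0.
  have := dp (- g); rewrite d0 dot0l => /le_trans/(_ (infS _ (-1) _)).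
  by rewrite scaleN1r subrr => /(_ K0); rewrite oppr_ge0 ler10.
move=> x Kx; have := dp (- x); rewrite dotNr dotNr dotC.
by move=> /le_trans; apply; apply: infS; rewrite scale0r add0r opprK.
Qed.

(** * Epiderivatives and support functions of polyhedra *)

Section Epiderivative.
Context {R : realType} {m : nat}.
Implicit Types (f : 'cV[R]_m -> \bar R) (x d g u w e : 'cV[R]_m).

(** Every neighbourhood in the lower limit contains pairs [(s, d)], so the ray in direction [d]
    alone gives an upper bound. *)
Lemma epiderivative_le f x d (a c : R) : f x = a%:E ->
  (\forall s \near (0 : R)^'+, f (x + s *: d)%R <= (a + s * c)%:E)%E ->
  (epiderivative f x d <= c%:E)%E.
Proof.
move=> fx fs; rewrite /epiderivative limf_einfE.
apply: ge_ereal_sup => _ [V [[A B] /= [A0 Bd] ABV] <-].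
have [s [[/= s0 As] fsc]] := filter_ex (filterI (filterI (nbhs_right_gt 0) A0) fs).
apply: le_trans (ereal_inf_lbound _) _.
  by exists (s, d); [apply: ABV; split=> //=; exact: nbhs_singleton|].
rewrite /= fx lee_pdivrMr // leeBlDr //.
by rewrite -EFinM -EFinD mulrC (addrC _ a).
Qed.

(** A subgradient bounds the difference quotient from below by [dot g d'], which tends to
    [dot g d]. *)
Lemma epiderivative_ge f x d g (a : R) : f x = a%:E ->
  (forall y, (a + dot g (y - x))%:E <= f y)%E ->
  ((dot g d)%:E <= epiderivative f x d)%E.
Proof.
move=> fx fg; apply/lee_addgt0Pr => e e0.
rewrite /epiderivative limf_einfE -leeBlDr //.
apply: le_trans (ereal_sup_ubound _); last first.
  exists [set z : R * 'cV[R]_m | 0 < z.1 /\ dot g d - e < dot g z.2]; last by [].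
  exists ([set s : R | 0 < s], [set d' | dot g d - e < dot g d']).
    split=> /=; first exact: nbhs_right_gt.
    by apply: (@dot_continuous _ _ g d [set r | dot g d - e < r]); apply: lt_nbhsr; lra.
  by move=> z [/= ? ?]; split.
apply: le_ereal_inf_tmp => _ [[s d'] /= [s0 gd'] <-].
rewrite fx lee_pdivlMr // leeBrDr // -EFinB -EFinM -EFinD.
apply: le_trans (fg _); rewrite lee_fin addrAC subrr add0r dotZr addrC.
by rewrite lerD2l mulrC ler_pM2l // ltW.
Qed.

Lemma indicatorE (S : set 'cV[R]_m) x : S x -> indicator S x = 0%E.
Proof. by move=> Sx; rewrite /indicator mem_set. Qed.

Lemma indicator_ge0 (S : set 'cV[R]_m) x : (0 <= indicator S x)%E.
Proof. by rewrite /indicator; case: ifP. Qed.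

Lemma indicator_fin_num (S : set 'cV[R]_m) x :
  indicator S x \is a fin_num -> S x.
Proof. by rewrite /indicator; case: ifP => // /set_mem. Qed.

(** A finite value puts [d] in the tangent cone of [S] at [u], and tangent vectors are polar to the
    normal cone, here the set of [z] with [dot x z] maximal over [S] at [u]. *)
Lemma epiderivative_indicator (S : set 'cV[R]_m) u d (r : R) : S u ->
  epiderivative (indicator S) u d = r%:E ->
  r = 0 /\ forall z, (forall x, S x -> dot x z <= dot u z) -> dot d z <= 0.
Proof.
move=> Su epi.
(* Without such a point the quotient would be [+oo] on a whole neighbourhood, and so would the lower
   limit. *)
have hit (A : set R) (B : set 'cV[R]_m) : (0 : R)^'+ A -> nbhs d B ->
    exists s d', [/\ 0 < s, A s, B d' & S (u + s *: d')].
  move=> A0 Bd; apply: contrapT => noS.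
  suff : (+oo <= epiderivative (indicator S) u d)%E by rewrite epi.
  rewrite /epiderivative limf_einfE.
  apply: le_trans (ereal_sup_ubound _); last first.
    exists [set z : R * 'cV[R]_m | (0 < z.1 /\ A z.1) /\ B z.2]; last by [].
    exists ([set s : R | 0 < s /\ A s], B); last by move=> z [/= ? ?]; split.
    by split=> //=; apply: filterI => //; exact: nbhs_right_gt.
  apply: le_ereal_inf_tmp => _ [[s d'] /= [[s0 As] Bd'] <-].
  rewrite (indicatorE Su) sube0 /indicator ifF; last first.
    by apply/negP => /set_mem ?; apply: noS; exists s, d'.
  by rewrite gt0_mulye // lte_fin invr_gt0.
split.
  apply/eqP; rewrite eq_le; apply/andP; split; last first.
    rewrite -lee_fin -epi -(dot0l d).
    apply: epiderivative_ge (indicatorE Su) _ => y.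
    by rewrite dot0l add0r indicator_ge0.
  rewrite -lee_fin -epi /epiderivative limf_einfE.
  apply: ge_ereal_sup => _ [V [[A B] /= [A0 Bd] ABV] <-].
  have [s [d' [s0 As Bd' Ss]]] := hit A B A0 Bd.
  apply: le_trans (ereal_inf_lbound _) _; first by exists (s, d'); [exact: ABV|].
  by rewrite /= !indicatorE // sube0 mul0e.
move=> z uz; rewrite leNgt; apply/negP => dz.
have [||s [d' [s0 _ /= d'z]]] := hit setT [set d' | 0 < dot z d'].
- exact: filterT.
- by apply: (@dot_continuous _ _ z d [set r | 0 < r]); apply: lt_nbhsr; rewrite dotC.
by move/uz; rewrite dotDl dotZl gerDl pmulr_rle0 // dotC leNgt d'z.
Qed.

End Epiderivative.

(** * Support functions and their conjugates *)

Section SupportFunction.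
Context {R : realType} {m : nat}.
Implicit Types (f : 'cV[R]_m -> \bar R) (x d e k u w : 'cV[R]_m).

Definition supports f : set 'cV[R]_m :=
  [set u | forall x, ((dot u x)%:E <= f x)%E].

(* The last clause expresses polyhedrality: along a ray [f] is eventually linear,
   unless the face of [supports f] exposed by [w] is unbounded in direction [e]. *)
Definition polyhedral_support f : Prop :=
  [/\ f 0 = 0%E,
      forall x (B : R), (forall u, supports f u -> dot u x <= B) ->
        (f x <= B%:E)%E
    & forall w e, f w \is a fin_num ->
        (exists u, [/\ supports f u, f w = (dot u w)%:E
           & \forall s \near (0 : R)^'+, f (w + s *: e) = (dot u (w + s *: e))%:E])
        \/ forall B : R, exists u, [/\ supports f u, f w = (dot u w)%:E
             & B < dot u e]].

(** On [supports f] the supremum is 0, reached at 0. Off it, some x has dot u x > f x, and scaling x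
    drives the supremum to [+oo]. *)
Lemma conjugate_support f :
  polyhedral_support f -> conjugate f = indicator (supports f).
Proof.
move=> [f0 fsup _]; apply/funext => u; rewrite /conjugate /indicator.
case: ifPn => [/set_mem Cu|Cu].
  apply/le_anti/andP; split.
    apply: ge_ereal_sup => _ [x _ <-].
    have := Cu x; case: (f x) => [r||//]; last by rewrite leNye.
    by rewrite -EFinB !lee_fin subr_le0.
  apply: le_ereal_sup_tmp; exists ((dot u 0%R)%:E - f 0%R)%E; first by exists 0.
  by rewrite f0 dot0r sube0.
(* If [supports f] were empty, -1 would bound it vacuously and force f 0 <= -1. The functional [v]
   then excludes f x = [-oo]. *)
have [v Cv] : exists v, supports f v.
  apply: contrapT => C0; have := fsup 0 (-1); rewrite f0 lee_fin oppr_ge0 ler10.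
  by move=> H; suff : false by []; apply: H => v Cv; case: C0; exists v.
have /existsNP[x /negP] : ~ supports f u by move=> /mem_set; apply/negP.
rewrite -ltNge => fxu.
have [r fx] : exists r, f x = r%:E.
  by have := Cv x; move: fxu; case: (f x) => [r|//|//] _ _; exists r.
have rv a v' : 0 <= a -> supports f v' -> dot v' (a *: x) <= a * r.
  by move=> a0 /(_ x); rewrite fx lee_fin dotZr => ?; exact: ler_wpM2l.
rewrite fx lte_fin -subr_gt0 in fxu; apply: eq_infty => B.
pose a := `|B| / (dot u x - r).
have a0 : 0 <= a by rewrite divr_ge0 // ltW.
apply: le_ereal_sup_tmp; exists ((dot u (a *: x)%R)%:E - f (a *: x)%R)%E.
  by exists (a *: x).
have := fsup _ _ (fun v' => rv a v' a0).
move=> /(leeB (lexx (dot u (a *: x))%:E)); apply: le_trans.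
rewrite -EFinB lee_fin dotZr -mulrBr divfK ?gt_eqF //; exact: ler_norm.
Qed.
(** Subgradients of an indicator are normal vectors: [u] maximizes the product with [w] over
    [supports f], and that maximum is [f w]. *)
Lemma subdiff_conjugate f u w :
  polyhedral_support f -> subdiff (conjugate f) u w ->
  supports f u /\ f w = (dot u w)%:E.
Proof.
move=> pf; rewrite (conjugate_support pf) => -[/indicator_fin_num Cu sub].
split=> //; apply/eqP; rewrite eq_le Cu andbT.
have [_ fsup _] := pf; apply: fsup => v Cv.
have := sub v; rewrite !indicatorE // add0e lee_fin dotBr subr_le0.
by rewrite !(dotC w).
Qed.

Lemma epiderivative_ge_dot f u w d :
  supports f u -> f w = (dot u w)%:E ->
  ((dot u d)%:E <= epiderivative f w d)%E.
Proof.
move=> Cu fw; apply: epiderivative_ge fw _ => y.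
by rewrite -dotDr addrC subrK; exact: Cu.
Qed.

(** The functional that is exact on the ray bounds the epiderivative from below as a subgradient and
    from above along the ray. *)
Lemma epiderivative_ray f w d : polyhedral_support f -> f w \is a fin_num ->
  (exists u, [/\ supports f u, f w = (dot u w)%:E,
     epiderivative f w d = (dot u d)%:E
     & \forall s \near (0 : R)^'+, f (w + s *: d) = (dot u (w + s *: d))%:E])
  \/ forall B : R, exists u, [/\ supports f u, f w = (dot u w)%:E & B < dot u d].
Proof.
move=> [_ _ ray] /(ray _ d)[[u [Cu fw fs]]|]; [left|by right].
exists u; split=> //; apply/eqP; rewrite eq_le epiderivative_ge_dot // andbT.
apply: epiderivative_le fw _; apply: filterS fs => s ->.
by rewrite dotDr dotZr.
Qed.

Lemma epiderivative_dir0 f w : polyhedral_support f -> f w \is a fin_num ->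
  epiderivative f w 0 = 0%E.
Proof.
move=> pf /(epiderivative_ray 0 pf)[[u [_ _ -> _]]|/(_ 0)[u [_ _]]].
  by rewrite dot0r.
by rewrite dot0r ltxx.
Qed.

(* [f] agrees with [dot u] at [w + s *: e] for small [s > 0], so [w + s *: e] is
   normal to [supports f] at [u], and [k] is tangent there. *)
Lemma epiderivative_polar f u w k e :
  polyhedral_support f -> supports f u -> f w = (dot u w)%:E ->
  epiderivative (conjugate f) u k = (dot w k)%:E ->
  epiderivative f w e = (dot u e)%:E -> dot k e <= 0.
Proof.
move=> pf Cu fw; rewrite (conjugate_support pf).
move=> /(epiderivative_indicator Cu)[wk polk] epi.
have fwfin : f w \is a fin_num by rewrite fw.
have [[v [Cv fwv epiv fs]]|/(_ (dot u e))[v [Cv fwv]]] := epiderivative_ray e pf fwfin.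
  have [s [s0 fse]] := filter_ex (filterI (nbhs_right_gt 0) fs).
  have vu : dot v e = dot u e by apply/eqP; rewrite -eqe -epi -epiv.
  have wvu : dot v w = dot u w by apply/eqP; rewrite -eqe -fw -fwv.
  have := polk (w + s *: e); rewrite (dotDr k) (dotZr _ k) (dotC k) wk add0r pmulr_rle0 //.
  apply=> x /(_ (w + s *: e)); rewrite fse lee_fin => /le_trans; apply.
  by rewrite !dotDr !dotZr vu wvu.
by have := epiderivative_ge_dot e Cv fwv; rewrite epi lee_fin leNgt => /negP.
Qed.

(** When [w] is normal to [supports f] at [u], these are the feasible directions at [u] of the face
    exposed by [w]. No closure is taken, so a whole segment stays in the set. *)
Definition radial_normal f u w : set 'cV[R]_m :=
  [set k | dot w k = 0 /\ exists2 t, 0 < t & supports f (u + t *: k)].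

Lemma supports_convex f u v (t : R) : 0 <= t <= 1 ->
  supports f u -> supports f v -> supports f (u + t *: (v - u)).
Proof.
move=> /andP[t0 t1] Cu Cv x; have := Cu x; have := Cv x.
case: (f x) => [r||] //; rewrite ?leey // !lee_fin => vx ux.
have vr := ler_wpM2l t0 vx.
have ur : (1 - t) * dot u x <= (1 - t) * r by rewrite ler_wpM2l // subr_ge0.
by rewrite dotDl dotZl dotBl; lra.
Qed.

Lemma supports_segment f u k (s t : R) : 0 <= s <= t -> 0 < t ->
  supports f u -> supports f (u + t *: k) -> supports f (u + s *: k).
Proof.
move=> /andP[s0 st] t0 Cu Ck.
have := @supports_convex _ _ _ (s / t) _ Cu Ck.
rewrite addrAC subrr add0r scalerA divfK ?gt_eqF //; apply.
by rewrite divr_ge0 ?(ltW t0) //= ler_pdivrMr // mul1r.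
Qed.

Lemma radial_normal0 f u w : supports f u -> radial_normal f u w 0.
Proof.
by move=> Cu; split; [rewrite dot0r | exists 1; rewrite ?scaler0 ?addr0].
Qed.

Lemma radial_normalZ f u w a k : 0 < a ->
  radial_normal f u w k -> radial_normal f u w (a *: k).
Proof.
move=> a0 [wk [t t0 Ck]]; split; first by rewrite dotZr wk mulr0.
by exists (t / a); rewrite ?divr_gt0 // scalerA divfK ?gt_eqF.
Qed.

Lemma radial_normalD f u w k e : supports f u ->
  radial_normal f u w k -> radial_normal f u w e -> radial_normal f u w (k + e).
Proof.
move=> Cu [wk [s s0 Ck]] [we [t t0 Ce]]; split; first by rewrite dotDr wk we addr0.
pose r := Num.min s t.
have r0 : 0 < r by rewrite lt_min s0.
have Ck' : supports f (u + r *: k).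
  by apply: (supports_segment _ _ Cu Ck); rewrite // ltW //= ge_min lexx.
have Ce' : supports f (u + r *: e).
  by apply: (supports_segment _ _ Cu Ce); rewrite // ltW //= ge_min lexx orbT.
exists (r / 2); first by rewrite divr_gt0.
(* This point is the midpoint of [u + r *: k] and [u + r *: e]. *)
have -> : u + (r / 2) *: (k + e) =
          u + r *: k + 2^-1 *: (u + r *: e - (u + r *: k)).
  by apply/matrixP => i j; rewrite !mxE; field.
by apply: supports_convex => //; lra.
Qed.

Lemma epiderivative_radial_normal f u w k :
  polyhedral_support f -> supports f u -> radial_normal f u w k ->
  epiderivative (conjugate f) u k = (dot w k)%:E.
Proof.
move=> pf Cu [-> [t t0 Ck]]; rewrite (conjugate_support pf).
apply/eqP; rewrite eq_le; apply/andP; split.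
  apply: epiderivative_le (indicatorE Cu) _.
  apply: filterS (filterI (nbhs_right_gt 0) (nbhs_right_lt t0)) => s [/= s0 st].
  rewrite indicatorE ?mulr0 ?addr0 //.
  by apply: (supports_segment _ _ Cu Ck); rewrite // !ltW.
rewrite -(dot0l k); apply: epiderivative_ge (indicatorE Cu) _ => y.
by rewrite dot0l add0r indicator_ge0.
Qed.

(** Each [v] in the face exposed by [w] gives the radial direction v - u, so [u] maximizes the
    product with [e] over that face, and [epiderivative_ray] identifies the epiderivative with this
    maximum. *)
Lemma epiderivative_of_polar f u w e :
  polyhedral_support f -> supports f u -> f w = (dot u w)%:E ->
  (forall k, radial_normal f u w k -> dot k e <= 0) ->
  epiderivative f w e = (dot u e)%:E.
Proof.
move=> pf Cu fw pol.
have face v : supports f v -> f w = (dot v w)%:E -> dot v e <= dot u e.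
  move=> Cv fwv; rewrite -subr_le0 -dotBl; apply: pol; split.
    by apply/eqP; rewrite dotC dotBl subr_eq0 -eqe -fw -fwv.
  by exists 1; rewrite // scale1r addrC subrK.
have fwfin : f w \is a fin_num by rewrite fw.
have [[v [Cv fwv epiv _]]|/(_ (dot u e))[v [Cv fwv]]] := epiderivative_ray e pf fwfin.
  apply/eqP; rewrite eq_le epiderivative_ge_dot // andbT epiv lee_fin.
  exact: face.
by rewrite ltNge face.
Qed.

End SupportFunction.

(** * The critical cone and the SRCQ *)

Lemma critical_coneP {R : realType} {m1 m2 : nat}
    (A : 'M[R]_(m2, m1)) (D : 'M[R]_m1) (b : 'cV[R]_m2)
    (h : 'cV[R]_m2 -> \bar R) (q : 'cV[R]_m1 -> \bar R) y u v d :
  polyhedral_support h -> polyhedral_support q -> kkt_solution A D b h q y u v ->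
  critical_cone A D b h q y d <->
  epiderivative h (A *m y - b) (A *m d) = (dot u (A *m d))%:E /\
  epiderivative q (D *m y) (D *m d) = (dot v (D *m d))%:E.
Proof.
move=> ph pq [stat /(subdiff_conjugate ph)[Cu hw] /(subdiff_conjugate pq)[Cv qz]].
have sum0 : dot u (A *m d) + dot v (D *m d) = 0.
  by rewrite -!dot_mulmx_tr -dotDl stat dot0l.
have := epiderivative_ge_dot (A *m d) Cu hw.
have := epiderivative_ge_dot (D *m d) Cv qz.
rewrite /critical_cone /=.
(* The lower bounds exclude [-oo], and a zero sum excludes [+oo]. The bounds themselves add up to 0,
   which leaves no slack in either. *)
case: (epiderivative h _ _) => [r1||]; case: (epiderivative q _ _) => [r2||] //=.
all: rewrite ?leeNy_eq ?lee_fin // => le1 le2; split=> [[]|[[]]] //.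
- by move=> r12; split; congr (_%:E); lra.
- by move=> -> [->]; rewrite -EFinD sum0.
Qed.

Lemma SRCQ_iff_critical_cone {R : realType} {m1 m2 : nat}
    (A : 'M[R]_(m2, m1)) (D : 'M[R]_m1) (b : 'cV[R]_m2)
    (h : 'cV[R]_m2 -> \bar R) (q : 'cV[R]_m1 -> \bar R) y u v :
  polyhedral_support h -> polyhedral_support q -> kkt_solution A D b h q y u v ->
  dual_SRCQ A D b h q y u v <-> critical_cone A D b h q y = [set 0].
Proof.
move=> ph pq kkt.
have critP d := @critical_coneP _ _ _ _ _ _ _ _ _ _ _ d ph pq kkt.
have [_ /(subdiff_conjugate ph)[Cu hw] /(subdiff_conjugate pq)[Cv qz]] := kkt.
rewrite /dual_SRCQ; split=> [srcq|crit0].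
  apply/seteqP; split=> [d /critP[epih epiq]|_ ->] /=.
    (* Decomposing [d] itself by the SRCQ gives dot d d = dot k1 (A d) + dot k2 (D d), and both
       terms are nonpositive by polarity. *)
    have : [set: 'cV[R]_m1] d by [].
    rewrite -srcq => -[k1 /= epik1 [k2 /= epik2 dE]].
    apply: dot_self_eq0; rewrite -{1}dE dotDl !dot_mulmx_tr.
    have := epiderivative_polar ph Cu hw epik1 epih.
    by have := epiderivative_polar pq Cv qz epik2 epiq; lra.
  apply/critP; rewrite !mulmx0 !dot0r.
  by rewrite !epiderivative_dir0 ?hw ?qz.
(* Radial normals give a convex cone inside the SRCQ set; showing that this smaller cone is
   everything suffices. *)
pose K := [set x | exists k1 k2, [/\ radial_normal h u (A *m y - b) k1,
  radial_normal q v (D *m y) k2 & x = A^T *m k1 + D^T *m k2]].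
have KT : K = setT.
  apply: contrapT => /(@cone_polar_nontrivial R m1 K)[||a x a0|d d0 pold].
  - exists 0, 0; split; [exact: radial_normal0..|].
    by rewrite !mulmx0 addr0.
  - move=> _ _ [k1 [k2 [N1 N2 ->]]] [e1 [e2 [M1 M2 ->]]].
    exists (k1 + e1), (k2 + e2); split; [exact: radial_normalD..|].
    by rewrite !mulmxDr addrACA.
  - move=> [k1 [k2 [N1 N2 ->]]].
    exists (a *: k1), (a *: k2); split; [exact: radial_normalZ..|].
    by rewrite -!scalemxAr scalerDr.
  - have : critical_cone A D b h q y d.
      apply/critP; split; apply: epiderivative_of_polar => // k Nk.
        rewrite -dot_mulmx_tr; apply: pold; exists k, 0; split=> //.
          exact: radial_normal0.
        by rewrite mulmx0 addr0.
      rewrite -dot_mulmx_tr; apply: pold; exists 0, k; split=> //.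
        exact: radial_normal0.
      by rewrite mulmx0 add0r.
    by rewrite crit0 => /eqP; rewrite (negbTE d0).
apply/seteqP; split=> // x _.
have : K x by rewrite KT.
move=> [k1 [k2 [N1 N2 ->]]].
exists k1; first exact: epiderivative_radial_normal.
by exists k2; first exact: epiderivative_radial_normal.
Qed.

(** * The orthant and the two norms *)

(** If [e] is nonpositive on the active coordinates of [w], short steps stay in the orthant and the
    functional 0 is exact. Otherwise multiples of [delta_mx i 0], with i active and e_i > 0, make
    the exposed face unbounded. *)
Lemma indicator_nonpos_polyhedral {R : realType} {m : nat} :
  polyhedral_support (indicator (@nonpos_orthant R m)).
Proof.
have Cdelta (i : 'I_m) (a : R) : 0 <= a ->
    supports (indicator (@nonpos_orthant R m)) (a *: delta_mx i 0).
  move=> a0 x; rewrite /indicator; case: ifP => [/set_mem xle0|]; last by rewrite leey.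
  by rewrite lee_fin dotZl dotC dot_delta mulr_ge0_le0.
have C0 : supports (indicator (@nonpos_orthant R m)) 0.
  by move=> x; rewrite dot0l indicator_ge0.
split.
- by rewrite indicatorE // => i; rewrite mxE.
- move=> x B xB; have [xle0|] := pselect (@nonpos_orthant R m x).
    by rewrite indicatorE // lee_fin -(dot0l x); exact: xB.
  move=> /existsNP[i /negP]; rewrite -ltNge => xi; exfalso.
  have := xB _ (Cdelta i ((`|B| + 1) / x i 0) _).
  rewrite dotZl dotC dot_delta divfK ?gt_eqF // => /(_ _).
  have : 0 <= (`|B| + 1) / x i 0 by rewrite divr_ge0 ?ltW // ltr_wpDl.
  by move=> /[swap] /[apply]; have := ler_norm B; lra.
- move=> w e /indicator_fin_num wle0; have [we|] := pselect
    (forall i, w i 0 = 0 -> e i 0 <= 0).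
    left; exists 0; split=> //; first by rewrite indicatorE // dot0l.
    suff : \forall s \near (0 : R)^'+, forall i, (w + s *: e) i 0 <= 0.
      by apply: filterS => s wse; rewrite indicatorE // dot0l.
    apply: filter_forall => i; have [w0|w0] := eqVneq (w i 0) 0.
      apply: filterS (nbhs_right_gt 0) => s s0.
      by rewrite !mxE w0 add0r mulr_ge0_le0 ?we // ltW.
    have wi : w i 0 < 0 by rewrite lt_neqAle w0 wle0.
    (* Below this step length s |e_i| < -w_i; the added 1 keeps the denominator positive. *)
    have d0 : 0 < - w i 0 / (`|e i 0| + 1) by rewrite divr_gt0 ?oppr_gt0 // ltr_wpDl.
    apply: filterS (filterI (nbhs_right_gt 0) (nbhs_right_lt d0)) => s [/= s0].
    rewrite ltr_pdivlMr ?ltr_wpDl // !mxE => sd.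
    have : s * e i 0 <= s * `|e i 0| by rewrite ler_wpM2l ?ler_norm // ltW.
    lra.
  move=> /existsNP[i /not_implyP[wi /negP]]; rewrite -ltNge => ei.
  right=> B; exists ((`|B| + 1) / e i 0 *: delta_mx i 0).
  split; first by apply: Cdelta; rewrite divr_ge0 ?ltW // ltr_wpDl.
    by rewrite indicatorE // dotZl dotC dot_delta wi mulr0.
  rewrite dotZl dotC dot_delta divfK ?gt_eqF //.
  by have := ler_norm B; lra.
Qed.

(** * Functions affine to the right of 0 *)

Definition right_affine {R : realType} (f : R -> R) : Prop :=
  exists c, \forall s \near (0 : R)^'+, f s = f 0 + s * c.

Section RightAffine.
Context {R : realType}.
Implicit Types f g : R -> R.

Lemma right_affine_lin (a c : R) : right_affine (fun s => a + s * c).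
Proof. by exists c; apply: filterE => s; rewrite mul0r addr0. Qed.

Lemma right_affineD f g :
  right_affine f -> right_affine g -> right_affine (fun s => f s + g s).
Proof.
move=> [c fc] [d gd]; exists (c + d).
by apply: filterS (filterI fc gd) => s [-> ->]; rewrite mulrDr addrACA.
Qed.

Lemma right_affine_near f c : (\forall s \near (0 : R)^'+, f s = f 0 + s * c) ->
  forall e, 0 < e -> \forall s \near (0 : R)^'+, `|f s - f 0| < e.
Proof.
move=> fc e e0; have d0 : 0 < e / (`|c| + 1) by rewrite divr_gt0 // ltr_wpDl.
apply: filterS (filterI fc (filterI (nbhs_right_gt 0) (nbhs_right_lt d0))).
move=> s [-> [/= s0]]; rewrite ltr_pdivlMr ?ltr_wpDl // => se.
by rewrite addrAC subrr add0r normrM gtr0_norm //; lra.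
Qed.

(** Near 0 the function with the larger value at 0 wins; when the values agree, the one with the
    larger slope does. *)
Lemma right_affine_max f g :
  right_affine f -> right_affine g -> right_affine (fun s => Num.max (f s) (g s)).
Proof.
wlog fg : f g / f 0 <= g 0 => [wl|] af ag.
  have [fg|/ltW gf] := leP (f 0) (g 0); first exact: wl.
  have [c Hc] := wl g f gf ag af; exists c.
  by apply: filterS Hc => s; rewrite !(maxC (g _)).
have [c fc] := af; have [d gd] := ag.
move: fg; rewrite le_eqVlt => /predU1P[fg|fg].
  exists (Num.max c d).
  apply: filterS (filterI (nbhs_right_gt 0) (filterI fc gd)) => s [/= s0 [-> ->]].
  by rewrite fg maxxx -addr_maxr maxr_pMr // ltW.
(* If each function moves by less than half the gap, they cannot cross. *)
have e0 : 0 < (g 0 - f 0) / 2 by lra.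
exists d; have fe := right_affine_near fc e0; have ge := right_affine_near gd e0.
apply: filterS (filterI gd (filterI fe ge)) => s [gs [fs]].
rewrite (max_r (ltW fg)) -gs => ges; apply: max_r.
by move: fs ges; rewrite !ltr_norml => /andP[_ ?] /andP[? _]; lra.
Qed.

Lemma right_affine_norm (a c : R) : right_affine (fun s => `|a + s * c|).
Proof.
have := right_affine_max (right_affine_lin a c) (right_affine_lin (- a) (- c)).
congr right_affine; apply/funext => s.
by rewrite mulrN -opprD maxrN.
Qed.

Lemma right_affine_big (op : R -> R -> R) (idx : R) (I : Type) (r : seq I)
    (F : I -> R -> R) :
  (forall f g, right_affine f -> right_affine g ->
     right_affine (fun s => op (f s) (g s))) ->
  (forall i, right_affine (F i)) ->
  right_affine (fun s => \big[op/idx]_(i <- r) F i s).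
Proof.
move=> opP FP; elim: r => [|i r IHr].
  have := right_affine_lin idx 0.
  by congr right_affine; apply/funext => s; rewrite big_nil mulr0 addr0.
have := opP _ _ (FP i) IHr.
by congr right_affine; apply/funext => s; rewrite big_cons.
Qed.

End RightAffine.

(* The support [v] of [Q] at a point [w + r *: e] interior to an interval where
   [Q] is affine must touch [Q] along the whole interval. *)
Lemma polyhedral_supportP {R : realType} {m : nat} (Q : 'cV[R]_m -> R) :
  (forall x, exists2 v, dot v x = Q x & forall z, dot v z <= Q z) ->
  (forall w e, right_affine (fun s => Q (w + s *: e))) ->
  polyhedral_support (fun x => (Q x)%:E).
Proof.
move=> sub aff; split.
- by have [v <- _] := sub 0; rewrite dot0r.
- by move=> x B xB; have [v <- vQ] := sub x; rewrite lee_fin; exact: xB.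
move=> w e _; left; have [c /nbhs_ballP[r /= r0 Qc]] := aff w e.
have {}Qc s : 0 < s -> s < r -> Q (w + s *: e) = Q w + s * c.
  move=> s0 sr; have := Qc s _ s0; rewrite scale0r addr0; apply.
  by rewrite /ball /= sub0r normrN gtr0_norm.
have [r2 r2r] : 0 < r / 2 /\ r / 2 < r by lra.
have [r3 r3r] : 0 < r * 3 / 4 /\ r * 3 / 4 < r by lra.
have [v vr vQ] := sub (w + (r / 2) *: e).
have := vQ (w + (r * 3 / 4) *: e); have := vQ w.
move: vr; rewrite !Qc // !dotDr !dotZr => vr vw vr3.
have vwQ : dot v w = Q w by lra.
have vec : dot v e = c by apply: (mulfI (lt0r_neq0 r0)); lra.
exists v; split=> //; first by rewrite vwQ.
apply: filterS (filterI (nbhs_right_gt 0) (nbhs_right_lt r0)) => s [/= s0 sr].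
by rewrite Qc // dotDr dotZr vwQ vec.
Qed.

(** * The two norms as polyhedral support functions *)

Lemma norm1_polyhedral {R : realType} {m : nat} :
  polyhedral_support (fun x : 'cV[R]_m => (norm1 x)%:E).
Proof.
apply: polyhedral_supportP => [x|w e].
  (* The sign vector is a subgradient of the 1-norm at [x]. *)
  exists (\col_i Num.sg (x i 0)) => [|z].
    by apply: eq_bigr => i _; rewrite mxE normrEsg.
  apply: ler_sum => i _; rewrite mxE; apply: le_trans (ler_norm _) _.
  by rewrite normrM ler_piMl // normr_sg; case: (_ != 0).
have -> : (fun s => norm1 (w + s *: e)) = (fun s => \sum_i `|w i 0 + s * e i 0|).
  by apply/funext => s; apply: eq_bigr => i _; rewrite !mxE.
apply: right_affine_big => [|i]; first exact: right_affineD.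
exact: right_affine_norm.
Qed.

Lemma norm_oo_polyhedral {R : realType} {m : nat} :
  polyhedral_support (fun x : 'cV[R]_m => (norm_oo x)%:E).
Proof.
apply: polyhedral_supportP => [x|w e].
  have [x0|] := eqVneq (mx_norm x) 0.
    exists 0 => [|z]; first by rewrite dot0l.
    by rewrite dot0l; exact: (normr_ge0 z).
  move=> /mx_norm_neq0[[i j] /=]; rewrite (ord1 j) => xi.
  (* A signed unit vector at a coordinate of largest modulus is a subgradient of the sup norm at
     [x]. *)
  exists (Num.sg (x i 0) *: delta_mx i 0) => [|z]; rewrite dotZl dotC dot_delta.
    by rewrite -normrEsg -xi.
  apply: le_trans (ler_norm _) _; rewrite normrM.
  apply: (@le_trans _ _ `|z i 0|).
    by rewrite ler_piMl // normr_sg; case: (_ != 0).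
  by rewrite /norm_oo mx_normrE (le_bigmax _ (fun k : 'I_m * 'I_1 => `|z k.1 k.2|) (i, 0)).
have -> : (fun s => norm_oo (w + s *: e)) =
  (fun s => \big[Num.max/0]_(k : 'I_m * 'I_1) `|w k.1 k.2 + s * e k.1 k.2|).
  apply/funext => s; rewrite /norm_oo mx_normrE.
  by apply: eq_bigr => k _; rewrite !mxE.
apply: right_affine_big => [|k]; first exact: right_affine_max.
exact: right_affine_norm.
Qed.

Unset Implicit Arguments.

Theorem theorem4p4 (R : realType) (n : nat) (hn : (3 <= n)%N)
    (Xt W : 'M[R]_n)
    (Xt_ge0 : forall i j : 'I_n, 0 <= Xt i j)
    (Xt_sym : Xt^T = Xt)
    (Xt_diag : forall i : 'I_n, Xt i i = 0)
    (W_sym : W^T = W)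
    (A : 'M[R]_(dim2 n, dim1 n)) (hA : A = triangle_mx R n)
    (b : 'cV[R]_(dim2 n)) (hb : b = - (A *m trivec Xt))
    (D : 'M[R]_(dim1 n)) (hD : D = diag_mx (trivec W)^T)
    (D_gt0 : forall p : 'I_(dim1 n), 0 < D p p)
    (h : 'cV[R]_(dim2 n) -> \bar R)
    (hh : h = indicator (@nonpos_orthant R (dim2 n)))
    (q : 'cV[R]_(dim1 n) -> \bar R)
    (hq : q = (fun y => (norm1 y)%:E) \/ q = (fun y => (norm_oo y)%:E))
    (y : 'cV[R]_(dim1 n)) (u : 'cV[R]_(dim2 n)) (v : 'cV[R]_(dim1 n))
    (kkt : kkt_solution A D b h q y u v) :
  dual_SRCQ A D b h q y u v <-> critical_cone A D b h q y = [set 0].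
Proof.
apply: SRCQ_iff_critical_cone kkt.
  by rewrite hh; exact: indicator_nonpos_polyhedral.
by case: hq => ->; [exact: norm1_polyhedral | exact: norm_oo_polyhedral].
Qed.
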